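(* Let $\mathcal L$ be a 2-z-exact 2-category. Let $K'\xrightarrow{k'}A'\xrightarrow{q'}Q'$ and $K\xrightarrow{k}A\xrightarrow{q}Q$ be short 2-exact sequences in $\mathcal L$, and let $f\colon K'\to K$, $g\colon A'\to A$, $h\colon Q'\to Q$ be 1-cells with invertible 2-cells $\phi_K\colon g\circ k'\cong k\circ f$ and $\phi_Q\colon h\circ q'\cong q\circ g$ (a morphism of short 2-exact sequences). Assume that $g$ is normal. 1. If $f$ and $h$ are 2-monomorphisms, then $g$ is a normal 2-monomorphism. 2. If $f$ and $h$ are 2-epimorphisms, then $g$ is a normal 2-epimorphism. 3. If $f$ and $h$ are equivalences, then $g$ is an equivalence.
   Context: 2-categories are strict; 1-cells are also called morphisms. For 1-cells, $\cong$ means that there is an invertible 2-cell between them. Whiskering is denoted $\star$. A bizero object of a 2-category $\mathcal L$ is an object $0$ such that for every object $A$ the hom-categories $\mathcal L(A,0)$ and $\mathcal L(0,A)$ are equivalent to the terminal category. A 1-cell is null if it factors through $0$; $f\cong 0$ means that $f$ is isomorphic to a null 1-cell. The bizero object is strong if between any two parallel 1-cells that factor through $0$ there is exactly one 2-cell. A 2-monomorphism is a 1-cell $f\colon A\to B$ such that for every object $Z$ the functor $f\circ(-)\colon\mathcal L(Z,A)\to\mathcal L(Z,B)$ is fully faithful. A 2-epimorphism is a 1-cell $f\colon A\to B$ such that for every $Z$ the functor $(-)\circ f\colon\mathcal L(B,Z)\to\mathcal L(A,Z)$ is fully faithful. In a 2-category with a strong bizero object, a 2-kernel of $f\colon A\to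 B$ is a 1-cell $k\colon K\to A$ with an invertible 2-cell $f\circ k\cong 0$ such that (1) for every $z\colon Z\to A$ with $f\circ z\cong0$ there is $u\colon Z\to K$ with $k\circ u\cong z$; (2) for all $u,v\colon Z\to K$ and every 2-cell $\lambda\colon k\circ u\Rightarrow k\circ v$ there is a unique 2-cell $\mu\colon u\Rightarrow v$ with $k\star\mu=\lambda$. 2-cokernels are defined dually. A 2-z-exact 2-category is a 2-category with a strong bizero object having all 2-kernels and all 2-cokernels. A normal 2-monomorphism is a 1-cell which is a 2-kernel of some 1-cell; a normal 2-epimorphism is a 1-cell which is a 2-cokernel of some 1-cell. A 1-cell is normal if it is isomorphic to $m\circ e$ with $e$ a normal 2-epimorphism and $m$ a normal 2-monomorphism. A short 2-exact sequence is a composable pair $K\xrightarrow{k}A\xrightarrow{q}Q$ such that $k$ is a 2-kernel of $q$ and $q$ is a 2-cokernel of $k$. *)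

(* Defs.v *)
Set Implicit Arguments.
Unset Strict Implicit.
Unset Printing Implicit Defensive.

Declare Scope cat_scope.
Delimit Scope cat_scope with cat.
Local Open Scope cat_scope.

Record category := Category {
  ob :> Type;
  arr : ob -> ob -> Type;
  idn : forall x, arr x x;
  cmp : forall x y z, arr y z -> arr x y -> arr x z;
  cmp_idl : forall x y (a : arr x y), cmp (idn y) a = a;
  cmp_idr : forall x y (a : arr x y), cmp a (idn x) = a;
  cmp_assoc : forall x y z t (c : arr z t) (b : arr y z) (a : arr x y),
    cmp c (cmp b a) = cmp (cmp c b) a
}.

Arguments arr {c} x y : rename.
Arguments idn {c} x : rename.
Arguments cmp {c x y z} b a : rename.

Notation "x ==> y" := (arr x y) (at level 55, no associativity) : cat_scope.
Notation "b <.> a" := (cmp b a) (at level 40, left associativity) : cat_scope.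

Definition invertible (C : category) (x y : C) (a : x ==> y) : Prop :=
  exists b : y ==> x, b <.> a = idn x /\ a <.> b = idn y.

Definition isomorphic (C : category) (x y : C) : Prop :=
  exists a : x ==> y, invertible a.

Notation "x ~= y" := (isomorphic x y) (at level 70, no associativity) : cat_scope.

Definition eq_arr (C : category) (x y : C) (e : x = y) : x ==> y :=
  match e in _ = z return x ==> z with eq_refl => idn x end.

Record functor (C D : category) := Functor {
  fob :> C -> D;
  farr : forall x y, x ==> y -> fob x ==> fob y;
  farr_id : forall x, farr (idn x) = idn (fob x);
  farr_cmp : forall x y z (b : y ==> z) (a : x ==> y),
    farr (b <.> a) = farr b <.> farr a
}.

Arguments farr {C D} f {x y} a : rename.

Definition id_functor (C : category) : functor C C :=
  @Functor C C (fun x => x) (fun _ _ a => a)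
    (fun _ => eq_refl) (fun _ _ _ _ _ => eq_refl).

Program Definition comp_functor (C D E : category)
    (G : functor D E) (F : functor C D) : functor C E :=
  @Functor C E (fun x => G (F x)) (fun _ _ a => farr G (farr F a)) _ _.
Next Obligation. intros; cbv beta; rewrite !farr_id; reflexivity. Qed.
Next Obligation. intros; cbv beta; rewrite !farr_cmp; reflexivity. Qed.

Definition naturally_isomorphic (C D : category) (F G : functor C D) : Prop :=
  exists eta : forall x, F x ==> G x,
    (forall x, invertible (eta x)) /\
    (forall x y (a : x ==> y), eta y <.> farr F a = farr G a <.> eta x).

Definition equivalent_categories (C D : category) : Prop :=
  exists (F : functor C D) (G : functor D C),
    naturally_isomorphic (comp_functor G F) (id_functor C) /\
    naturally_isomorphic (comp_functor F G) (id_functor D).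

Definition fully_faithful (C D : category) (F : functor C D) : Prop :=
  forall (x y : C) (b : F x ==> F y), exists! a : x ==> y, farr F a = b.

Program Definition terminal_category : category :=
  @Category unit (fun _ _ => unit) (fun _ => tt) (fun _ _ _ _ _ => tt) _ _ _.
Next Obligation. intros x y a; destruct a; reflexivity. Qed.
Next Obligation. intros x y a; destruct a; reflexivity. Qed.
Next Obligation. reflexivity. Qed.

(** Composition of 1-cells is associative and unital up to [=].  The
    corresponding laws for horizontal composition of 2-cells relate 2-cells
    whose boundaries are equal but not convertible; [eq_arr] mediates. *)

Record two_category := TwoCategory {
  ob2 :> Type;
  Hom : ob2 -> ob2 -> category;
  one : forall A, Hom A A;
  comp : forall A B C, Hom B C -> Hom A B -> Hom A C;
  hcomp : forall A B C (g g' : Hom B C) (f f' : Hom A B),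
    g ==> g' -> f ==> f' -> comp g f ==> comp g' f';
  hcomp_id : forall A B C (g : Hom B C) (f : Hom A B),
    hcomp (idn g) (idn f) = idn (comp g f);
  interchange : forall A B C (g g' g'' : Hom B C) (f f' f'' : Hom A B)
      (b' : g' ==> g'') (b : g ==> g') (a' : f' ==> f'') (a : f ==> f'),
    hcomp (b' <.> b) (a' <.> a) = hcomp b' a' <.> hcomp b a;
  comp_assoc : forall A B C D (h : Hom C D) (g : Hom B C) (f : Hom A B),
    comp h (comp g f) = comp (comp h g) f;
  comp_1l : forall A B (f : Hom A B), comp (one B) f = f;
  comp_1r : forall A B (f : Hom A B), comp f (one A) = f;
  hcomp_assoc : forall A B C D (h h' : Hom C D) (g g' : Hom B C) (f f' : Hom A B)
      (c : h ==> h') (b : g ==> g') (a : f ==> f'),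
    eq_arr (comp_assoc h' g' f') <.> hcomp c (hcomp b a)
    = hcomp (hcomp c b) a <.> eq_arr (comp_assoc h g f);
  hcomp_1l : forall A B (f f' : Hom A B) (a : f ==> f'),
    eq_arr (comp_1l f') <.> hcomp (idn (one B)) a = a <.> eq_arr (comp_1l f);
  hcomp_1r : forall A B (f f' : Hom A B) (a : f ==> f'),
    eq_arr (comp_1r f') <.> hcomp a (idn (one A)) = a <.> eq_arr (comp_1r f)
}.

Arguments Hom {t} A B : rename.
Arguments one {t} A : rename.
Arguments comp {t A B C} g f : rename.
Arguments hcomp {t A B C g g' f f'} b a : rename.

Notation "g <o> f" := (comp g f) (at level 40, left associativity) : cat_scope.

Definition whisker_l (L : two_category) (A B C : L) (g : Hom B C)
    (f f' : Hom A B) (a : f ==> f') : g <o> f ==> g <o> f' :=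
  hcomp (idn g) a.

Definition whisker_r (L : two_category) (A B C : L) (g g' : Hom B C)
    (b : g ==> g') (f : Hom A B) : g <o> f ==> g' <o> f :=
  hcomp b (idn f).

Arguments whisker_l {L A B C} g {f f'} a.
Arguments whisker_r {L A B C g g'} b f.

Program Definition postcomp (L : two_category) (A B : L) (f : Hom A B) (Z : L) :
    functor (Hom Z A) (Hom Z B) :=
  @Functor (Hom Z A) (Hom Z B) (fun u => f <o> u) (fun _ _ a => whisker_l f a) _ _.
Next Obligation. intros; apply hcomp_id. Qed.
Next Obligation.
intros; cbv beta; unfold whisker_l; rewrite <- interchange, cmp_idl; reflexivity.
Qed.

Program Definition precomp (L : two_category) (A B : L) (f : Hom A B) (Z : L) :
    functor (Hom B Z) (Hom A Z) :=
  @Functor (Hom B Z) (Hom A Z) (fun u => u <o> f) (fun _ _ a => whisker_r a f) _ _.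
Next Obligation. intros; apply hcomp_id. Qed.
Next Obligation.
intros; cbv beta; unfold whisker_r; rewrite <- interchange, cmp_idl; reflexivity.
Qed.

Definition is_2mono (L : two_category) (A B : L) (f : Hom A B) : Prop :=
  forall Z : L, fully_faithful (postcomp f Z).

Definition is_2epi (L : two_category) (A B : L) (f : Hom A B) : Prop :=
  forall Z : L, fully_faithful (precomp f Z).

Definition is_equivalence (L : two_category) (A B : L) (f : Hom A B) : Prop :=
  exists g : Hom B A, g <o> f ~= one A /\ f <o> g ~= one B.

Definition is_bizero (L : two_category) (O : L) : Prop :=
  forall A : L,
    equivalent_categories (Hom A O) terminal_category /\
    equivalent_categories (Hom O A) terminal_category.

Definition factors_through (L : two_category) (O A B : L) (f : Hom A B) : Prop :=
  exists (a : Hom A O) (b : Hom O B), f = b <o> a.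

Definition is_strong_bizero (L : two_category) (O : L) : Prop :=
  is_bizero O /\
  forall (A B : L) (f g : Hom A B),
    factors_through O f -> factors_through O g ->
    exists! a : f ==> g, True.

Record bizero_2category := Bizero2Category {
  underlying :> two_category;
  zero : underlying;
  zero_strong : is_strong_bizero zero
}.

Arguments zero {b} : rename.

Section Exactness.

Context {L : bizero_2category}.

Definition null (A B : L) (f : Hom A B) : Prop := factors_through zero f.

Definition iso_null (A B : L) (f : Hom A B) : Prop :=
  exists n : Hom A B, null n /\ f ~= n.

(** The invertible 2-cell from [f <o> k] to a null 1-cell is only required to
    exist: by strength of the bizero object it is unique once its target is
    fixed, and any two targets are uniquely isomorphic. *)
Definition is_2kernel (A B K : L) (f : Hom A B) (k : Hom K A) : Prop :=
  iso_null (f <o> k) /\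
  (forall (Z : L) (z : Hom Z A), iso_null (f <o> z) ->
     exists u : Hom Z K, k <o> u ~= z) /\
  (forall (Z : L) (u v : Hom Z K) (l : k <o> u ==> k <o> v),
     exists! m : u ==> v, whisker_l k m = l).

Definition is_2cokernel (A B Q : L) (f : Hom A B) (q : Hom B Q) : Prop :=
  iso_null (q <o> f) /\
  (forall (Z : L) (z : Hom B Z), iso_null (z <o> f) ->
     exists u : Hom Q Z, u <o> q ~= z) /\
  (forall (Z : L) (u v : Hom Q Z) (l : u <o> q ==> v <o> q),
     exists! m : u ==> v, whisker_r m q = l).

Definition is_normal_2mono (A B : L) (m : Hom A B) : Prop :=
  exists (C : L) (f : Hom B C), is_2kernel f m.

Definition is_normal_2epi (A B : L) (e : Hom A B) : Prop :=
  exists (C : L) (f : Hom C A), is_2cokernel f e.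

Definition is_normal (A B : L) (f : Hom A B) : Prop :=
  exists (I : L) (e : Hom A I) (m : Hom I B),
    is_normal_2epi e /\ is_normal_2mono m /\ f ~= m <o> e.

Definition short_2exact (K A Q : L) (k : Hom K A) (q : Hom A Q) : Prop :=
  is_2kernel q k /\ is_2cokernel k q.

End Exactness.

Definition is_2z_exact (L : bizero_2category) : Prop :=
  forall (A B : L) (f : Hom A B),
    (exists (K : L) (k : Hom K A), is_2kernel f k) /\
    (exists (Q : L) (q : Hom B Q), is_2cokernel f q).

(* Main.v *)
Require Import Defs.
From Corelib Require Setoid.
Set Implicit Arguments.
Unset Strict Implicit.
Local Open Scope cat_scope.

(** Write [g ~= m <o> e] with [e] a 2-cokernel of some [w] and [m] a 2-kernel.

    Suppose that [f] and [h] are 2-monomorphisms.  Then [g <o> w] is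
    isomorphic to a null 1-cell, because [e <o> w] is.  As [h] reflects null
    1-cells and [h <o> q' ~= q <o> g], the 1-cell [q' <o> w] is null up to
    isomorphism, so [w ~= k' <o> u] for some [u].  Now
    [k <o> f <o> u ~= g <o> w], and [k] and [f] reflect null 1-cells, so [u],
    and hence [w], is null up to isomorphism.  A 2-cokernel of such a [w] is an
    equivalence: the identity factors through it, and it is a 2-epimorphism.
    So [e] is an equivalence ([epi_part_is_equivalence]), and [g], being
    isomorphic to a 2-kernel precomposed with an equivalence, is a 2-kernel
    ([is_2kernel_precomp_equivalence]).

    The second part is the first one in the 2-category with reversed 1-cells
    [opposite], where 2-kernels become 2-cokernels; there the argument shows
    that [m] is an equivalence.  Equivalences are both 2-monomorphisms and
    2-epimorphisms, so in the third part both [e] and [m] are equivalences,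
    and so is [g]. *)

(** * Isomorphisms and fully faithful functors *)

Lemma isomorphic_refl (C : category) (x : C) : x ~= x.
Proof. exists (idn x), (idn x); split; apply cmp_idl. Qed.

Lemma isomorphic_sym (C : category) (x y : C) : x ~= y -> y ~= x.
Proof. intros [a [b [H1 H2]]]; exists b, a; split; assumption. Qed.

Lemma invertible_cmp (C : category) (x y z : C) (b : y ==> z) (a : x ==> y) :
  invertible b -> invertible a -> invertible (b <.> a).
Proof.
intros [b' [Hb1 Hb2]] [a' [Ha1 Ha2]]; exists (a' <.> b'); split.
- rewrite cmp_assoc, <- (cmp_assoc a' b' b), Hb1, cmp_idr; exact Ha1.
- rewrite cmp_assoc, <- (cmp_assoc b a a'), Ha2, cmp_idr; exact Hb2.
Qed.

Lemma isomorphic_trans (C : category) (x y z : C) :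
  x ~= y -> y ~= z -> x ~= z.
Proof.
intros [a Ha] [b Hb]; exists (b <.> a); apply invertible_cmp; assumption.
Qed.

Add Parametric Relation (C : category) : (ob C) (@isomorphic C)
  reflexivity proved by (@isomorphic_refl C)
  symmetry proved by (@isomorphic_sym C)
  transitivity proved by (@isomorphic_trans C)
  as isomorphic_rel.

Lemma eq_arr_symK (C : category) (x y : C) (e : x = y) :
  eq_arr (eq_sym e) <.> eq_arr e = idn x.
Proof. destruct e; apply cmp_idl. Qed.

Lemma eq_arrK_sym (C : category) (x y : C) (e : x = y) :
  eq_arr e <.> eq_arr (eq_sym e) = idn y.
Proof. destruct e; apply cmp_idl. Qed.

Lemma invertible_eq_arr (C : category) (x y : C) (e : x = y) :
  invertible (eq_arr e).
Proof.
exists (eq_arr (eq_sym e)); split; [apply eq_arr_symK | apply eq_arrK_sym].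
Qed.

Lemma invertible_cancel_l (C : category) (x y z : C) (b : y ==> z)
    (a a' : x ==> y) : invertible b -> b <.> a = b <.> a' -> a = a'.
Proof.
intros [b' [H _]] E.
rewrite <- (cmp_idl a), <- (cmp_idl a'), <- H, <- !cmp_assoc, E; reflexivity.
Qed.

Lemma invertible_cancel_r (C : category) (x y z : C) (a : x ==> y)
    (b b' : y ==> z) : invertible a -> b <.> a = b' <.> a -> b = b'.
Proof.
intros [a' [_ H]] E.
rewrite <- (cmp_idr b), <- (cmp_idr b'), <- H, !cmp_assoc, E; reflexivity.
Qed.

Lemma fully_faithful_inj (C D : category) (F : functor C D) (x y : C)
    (a a' : x ==> y) : fully_faithful F -> farr F a = farr F a' -> a = a'.
Proof.
intros HF E; destruct (HF x y (farr F a)) as [c [_ Hc]].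
rewrite <- (Hc a eq_refl); apply Hc; symmetry; exact E.
Qed.

Lemma fully_faithful_isomorphic (C D : category) (F : functor C D) (x y : C) :
  fully_faithful F -> F x ~= F y -> x ~= y.
Proof.
intros HF [b [b' [H1 H2]]].
destruct (HF _ _ b) as [a [Ha _]]; destruct (HF _ _ b') as [a' [Ha' _]].
exists a, a'; split; apply (fully_faithful_inj HF);
  rewrite farr_cmp, farr_id, Ha, Ha'; assumption.
Qed.

Lemma fully_faithful_comp (C D E : category) (G : functor D E)
    (F : functor C D) :
  fully_faithful G -> fully_faithful F -> fully_faithful (comp_functor G F).
Proof.
intros HG HF x y b; simpl in *.
destruct (HG _ _ b) as [c [Hc _]]; destruct (HF _ _ c) as [a [Ha _]].
exists a; split; [rewrite Ha; exact Hc |].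
intros a' Ha'; apply (fully_faithful_inj HF), (fully_faithful_inj HG).
rewrite Ha, Hc, Ha'; reflexivity.
Qed.

Lemma natiso_trans (C D : category) (F G H : functor C D) :
  naturally_isomorphic F G -> naturally_isomorphic G H ->
  naturally_isomorphic F H.
Proof.
intros [s [Hs Ns]] [t [Ht Nt]]; exists (fun x => t x <.> s x); split.
- intro x; apply invertible_cmp; auto.
- intros x y a; rewrite <- cmp_assoc, Ns, cmp_assoc, Nt, <- cmp_assoc.
  reflexivity.
Qed.

(** The components of a natural isomorphism are only known to have inverses,
    so reversing it would need choice; transport of full faithfulness is
    therefore proved separately in both directions. *)
Lemma fully_faithful_natiso_target (C D : category) (F G : functor C D) :
  naturally_isomorphic F G -> fully_faithful G -> fully_faithful F.
Proof.
intros [eta [Hinv Hnat]] HG x y b.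
destruct (Hinv x) as [ix [Hx1 Hx2]].
destruct (HG _ _ (eta y <.> b <.> ix)) as [a [Ha _]].
exists a; split.
- apply (invertible_cancel_l (Hinv y)).
  rewrite Hnat, Ha, <- cmp_assoc, Hx1, cmp_idr; reflexivity.
- intros a' Ha'; apply (fully_faithful_inj HG).
  apply (invertible_cancel_r (Hinv x)).
  rewrite Ha, <- cmp_assoc, Hx1, cmp_idr, <- Ha', Hnat; reflexivity.
Qed.

Lemma fully_faithful_natiso_source (C D : category) (F G : functor C D) :
  naturally_isomorphic F G -> fully_faithful F -> fully_faithful G.
Proof.
intros [eta [Hinv Hnat]] HF x y b.
destruct (Hinv y) as [iy [Hy1 Hy2]].
destruct (HF _ _ (iy <.> (b <.> eta x))) as [a [Ha _]].
exists a; split.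
- apply (invertible_cancel_r (Hinv x)).
  rewrite <- Hnat, Ha, cmp_assoc, Hy2, cmp_idl; reflexivity.
- intros a' Ha'; apply (fully_faithful_inj HF).
  apply (invertible_cancel_l (Hinv y)).
  rewrite Ha, cmp_assoc, Hy2, cmp_idl, <- Ha', Hnat; reflexivity.
Qed.

Lemma fully_faithful_id (C : category) : fully_faithful (id_functor C).
Proof.
intros x y b; exists b; split; [reflexivity | intros a H; symmetry; exact H].
Qed.

(** [F] is faithful since [G F] is, and likewise [G] is faithful since [F G]
    is; a preimage of [b] under [F] is a preimage of [G b] under [G F]. *)
Lemma fully_faithful_quasi_inverse (C D : category) (F : functor C D)
    (G : functor D C) :
  naturally_isomorphic (comp_functor G F) (id_functor C) ->
  naturally_isomorphic (comp_functor F G) (id_functor D) ->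
  fully_faithful F.
Proof.
intros HGF HFG x y b.
pose proof (fully_faithful_natiso_target HGF (@fully_faithful_id C)) as fGF.
pose proof (fully_faithful_natiso_target HFG (@fully_faithful_id D)) as fFG.
destruct (fGF x y (farr G b)) as [a [Ha Ua]].
exists a; split.
- apply (fully_faithful_inj fFG); simpl in *; rewrite Ha; reflexivity.
- intros a' Ha'; apply Ua; simpl; rewrite Ha'; reflexivity.
Qed.

(** * 1-cells up to isomorphism *)

Lemma isomorphic_comp (L : two_category) (A B C : L) (g g' : Hom B C)
    (f f' : Hom A B) : g ~= g' -> f ~= f' -> g <o> f ~= g' <o> f'.
Proof.
intros [b [b' [Hb1 Hb2]]] [a [a' [Ha1 Ha2]]].
exists (hcomp b a), (hcomp b' a'); split;
  rewrite <- interchange, ?Hb1, ?Hb2, ?Ha1, ?Ha2; apply hcomp_id.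
Qed.

Add Parametric Morphism (L : two_category) (A B C : L) : (@comp L A B C)
  with signature (Corelib.Classes.Morphisms.respectful (@isomorphic (Hom B C))
    (Corelib.Classes.Morphisms.respectful (@isomorphic (Hom A B)) (@isomorphic (Hom A C))))
  as comp_isomorphic_morphism.
Proof. intros g g' Hg f f' Hf; apply isomorphic_comp; assumption. Qed.

Lemma postcomp_natiso (L : two_category) (A B Z : L) (f f' : Hom A B) :
  f ~= f' -> naturally_isomorphic (postcomp f Z) (postcomp f' Z).
Proof.
intros [a [a' [H1 H2]]]; exists (fun u => whisker_r a u); split.
- intro u; exists (whisker_r a' u); unfold whisker_r; simpl.
  split; rewrite <- interchange, ?H1, ?H2, cmp_idl; apply hcomp_id.
- intros u v b; simpl; unfold whisker_r, whisker_l.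
  rewrite <- !interchange, !cmp_idl, !cmp_idr; reflexivity.
Qed.

Lemma postcomp_comp_natiso (L : two_category) (A B C Z : L) (g : Hom B C)
    (f : Hom A B) :
  naturally_isomorphic (comp_functor (postcomp g Z) (postcomp f Z))
    (postcomp (g <o> f) Z).
Proof.
exists (fun u => eq_arr (comp_assoc g f u)); split.
- intro u; apply invertible_eq_arr.
- intros u v a; simpl; unfold whisker_l.
  rewrite hcomp_assoc, hcomp_id; reflexivity.
Qed.

Lemma postcomp_one_natiso (L : two_category) (A Z : L) :
  naturally_isomorphic (postcomp (one A) Z) (id_functor (Hom Z A)).
Proof.
exists (fun u => eq_arr (comp_1l u)); split.
- intro u; apply invertible_eq_arr.
- intros u v a; simpl; unfold whisker_l; apply hcomp_1l.
Qed.

(** * 2-monomorphisms and equivalences *)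

Lemma is_2mono_comp (L : two_category) (A B C : L) (g : Hom B C)
    (f : Hom A B) (gf : Hom A C) :
  is_2mono g -> is_2mono f -> gf ~= g <o> f -> is_2mono gf.
Proof.
intros Hg Hf E Z.
apply (fully_faithful_natiso_target (postcomp_natiso Z E)).
apply (fully_faithful_natiso_source (postcomp_comp_natiso Z g f)).
apply fully_faithful_comp; [apply Hg | apply Hf].
Qed.

Lemma is_equivalence_2mono (L : two_category) (A B : L) (f : Hom A B) :
  is_equivalence f -> is_2mono f.
Proof.
intros [g [Hgf Hfg]] Z.
apply (@fully_faithful_quasi_inverse _ _ (postcomp f Z) (postcomp g Z)).
- exact (natiso_trans (postcomp_comp_natiso Z g f)
    (natiso_trans (postcomp_natiso Z Hgf) (postcomp_one_natiso A Z))).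
- exact (natiso_trans (postcomp_comp_natiso Z f g)
    (natiso_trans (postcomp_natiso Z Hfg) (postcomp_one_natiso B Z))).
Qed.

Lemma is_2mono_isomorphic (L : two_category) (A B Z : L) (f : Hom A B)
    (u v : Hom Z A) : is_2mono f -> f <o> u ~= f <o> v -> u ~= v.
Proof. intros Hf; exact (fully_faithful_isomorphic (Hf Z)). Qed.

Lemma is_2epi_isomorphic (L : two_category) (A B Z : L) (f : Hom A B)
    (u v : Hom B Z) : is_2epi f -> u <o> f ~= v <o> f -> u ~= v.
Proof. intros Hf; exact (fully_faithful_isomorphic (Hf Z)). Qed.

Lemma is_equivalence_comp (L : two_category) (A B C : L) (g : Hom B C)
    (f : Hom A B) (gf : Hom A C) :
  is_equivalence g -> is_equivalence f -> gf ~= g <o> f -> is_equivalence gf.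
Proof.
intros [g' [Hg1 Hg2]] [f' [Hf1 Hf2]] E; exists (f' <o> g'); split; rewrite E.
- rewrite comp_assoc, <- (comp_assoc f' g' g), Hg1, comp_1r; exact Hf1.
- rewrite comp_assoc, <- (comp_assoc g f f'), Hf2, comp_1r; exact Hg2.
Qed.

(** * Null 1-cells *)

Section Exactness.

Context {L : bizero_2category}.

Lemma iso_null_isomorphic (A B : L) (f g : Hom A B) :
  f ~= g -> iso_null g -> iso_null f.
Proof.
intros E [n [Hn Hgn]]; exists n; split; [exact Hn | rewrite E; exact Hgn].
Qed.

Lemma iso_null_comp_l (A B C : L) (g : Hom B C) (f : Hom A B) :
  iso_null f -> iso_null (g <o> f).
Proof.
intros [n [[a [b ->]] E]]; exists (g <o> (b <o> a)); split.
- exists a, (g <o> b); apply comp_assoc.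
- rewrite E; reflexivity.
Qed.

Lemma iso_null_comp_r (A B C : L) (g : Hom B C) (f : Hom A B) :
  iso_null g -> iso_null (g <o> f).
Proof.
intros [n [[a [b ->]] E]]; exists (b <o> a <o> f); split.
- exists (a <o> f), b; symmetry; apply comp_assoc.
- rewrite E; reflexivity.
Qed.

Lemma null_isomorphic (A B : L) (f g : Hom A B) : null f -> null g -> f ~= g.
Proof.
intros Hf Hg; destruct (zero_strong L) as [_ S].
destruct (S A B f g Hf Hg) as [a _]; destruct (S A B g f Hg Hf) as [b _].
exists a, b; split.
- destruct (S A B f f Hf Hf) as [c [_ Hc]].
  rewrite <- (Hc (b <.> a) I); apply Hc; exact I.
- destruct (S A B g g Hg Hg) as [c [_ Hc]].
  rewrite <- (Hc (a <.> b) I); apply Hc; exact I.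
Qed.

Lemma null_exists (A B : L) : exists n : Hom A B, null n.
Proof.
destruct (zero_strong L) as [Z _].
destruct (Z A) as [[_ [F _]] _], (Z B) as [_ [_ [G _]]].
exists (G tt <o> F tt), (F tt), (G tt); reflexivity.
Qed.

(** A 2-monomorphism sends a null 1-cell to a null 1-cell and reflects
    isomorphism, hence reflects being isomorphic to a null 1-cell. *)
Lemma is_2mono_iso_null (A B Z : L) (f : Hom A B) (y : Hom Z A) :
  is_2mono f -> iso_null (f <o> y) -> iso_null y.
Proof.
intros Hf [n [Hn E]]; destruct (null_exists Z A) as [n' Hn'].
exists n'; split; [exact Hn' |].
apply (is_2mono_isomorphic Hf); rewrite E.
apply null_isomorphic; [exact Hn |].
destruct Hn' as [a [b ->]]; exists a, (f <o> b); apply comp_assoc.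
Qed.

(** * 2-kernels and 2-cokernels *)

Lemma is_2kernel_2mono (A B K : L) (c : Hom A B) (k : Hom K A) :
  is_2kernel c k -> is_2mono k.
Proof. intros [_ [_ H]]; exact H. Qed.

Lemma is_2cokernel_2epi (A B Q : L) (c : Hom A B) (q : Hom B Q) :
  is_2cokernel c q -> is_2epi q.
Proof. intros [_ [_ H]]; exact H. Qed.

(** The identity of [B] factors as [u <o> e]; cancelling the 2-epimorphism [e]
    in [e <o> u <o> e ~= e] shows that [u] is also a section of [e]. *)
Lemma is_2cokernel_iso_null_equivalence (A B Q : L) (w : Hom A B)
    (e : Hom B Q) : is_2cokernel w e -> iso_null w -> is_equivalence e.
Proof.
intros He Hw; destruct (He) as [_ [Hfac _]].
destruct (Hfac _ (one B)) as [u Hu]; [apply iso_null_comp_l, Hw |].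
exists u; split; [exact Hu |].
apply (is_2epi_isomorphic (is_2cokernel_2epi He)).
rewrite <- comp_assoc, Hu, comp_1l, comp_1r; reflexivity.
Qed.

Lemma is_2kernel_precomp_equivalence (A B K K' : L) (c : Hom A B)
    (m : Hom K A) (e : Hom K' K) (g : Hom K' A) :
  is_2kernel c m -> is_equivalence e -> g ~= m <o> e -> is_2kernel c g.
Proof.
intros Hm He E; split; [| split].
- apply (@iso_null_isomorphic _ _ _ (c <o> m <o> e)).
  + rewrite E, comp_assoc; reflexivity.
  + apply iso_null_comp_r, Hm.
- intros Z z Hz; destruct Hm as [_ [Hfac _]].
  destruct (Hfac Z z Hz) as [v Hv]; destruct He as [u [_ Heu]].
  exists (u <o> v).
  rewrite E, comp_assoc, <- (comp_assoc m e u), Heu, comp_1r; exact Hv.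
- exact (is_2mono_comp (is_2kernel_2mono Hm) (is_equivalence_2mono He) E).
Qed.

(** The chase behind all three parts: [w] dies under [g], hence under [q']
    because [h] reflects null 1-cells, hence factors through [k'] by a 1-cell
    that dies under [k <o> f].  So [e] is a 2-cokernel of a null 1-cell. *)
Lemma epi_part_is_equivalence (K' A' Q' K A Q I W : L)
    (k' : Hom K' A') (q' : Hom A' Q') (k : Hom K A) (q : Hom A Q)
    (f : Hom K' K) (g : Hom A' A) (h : Hom Q' Q)
    (w : Hom W A') (e : Hom A' I) (m : Hom I A) :
  is_2kernel q' k' -> is_2mono k ->
  g <o> k' ~= k <o> f -> h <o> q' ~= q <o> g ->
  is_2cokernel w e -> g ~= m <o> e ->
  is_2mono f -> is_2mono h -> is_equivalence e.
Proof.
intros Hk' Hk EK EQ He E Hf Hh.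
apply (is_2cokernel_iso_null_equivalence He).
assert (Hgw : iso_null (g <o> w)).
{ apply (@iso_null_isomorphic _ _ _ (m <o> (e <o> w))).
  - rewrite E, comp_assoc; reflexivity.
  - apply iso_null_comp_l, He. }
assert (Hqw : iso_null (q' <o> w)).
{ apply (is_2mono_iso_null Hh).
  apply (@iso_null_isomorphic _ _ _ (q <o> (g <o> w))).
  - rewrite !comp_assoc, EQ; reflexivity.
  - apply iso_null_comp_l, Hgw. }
destruct Hk' as [_ [Hfac _]]; destruct (Hfac _ w Hqw) as [u Hu].
apply (@iso_null_isomorphic _ _ _ (k' <o> u)); [symmetry; exact Hu |].
apply iso_null_comp_l, (is_2mono_iso_null Hf), (is_2mono_iso_null Hk).
apply (@iso_null_isomorphic _ _ _ (g <o> w)); [| exact Hgw].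
rewrite comp_assoc, <- EK, <- comp_assoc, Hu; reflexivity.
Qed.

End Exactness.

(** * Duality *)

(** The 2-category with 1-cells reversed and 2-cells unchanged. *)
Definition opposite_two_category (L : two_category) : two_category.
Proof.
refine (@TwoCategory (ob2 L) (fun A B => @Hom L B A) (fun A => one A)
  (fun A B C g f => f <o> g)
  (fun A B C g g' f f' b a => hcomp a b)
  _ _
  (fun A B C D h g f => eq_sym (comp_assoc f g h))
  (fun A B f => comp_1r f) (fun A B f => comp_1l f) _ _ _); intros.
- apply hcomp_id.
- apply interchange.
- (* [hcomp_assoc] read from right to left, with its two coherence cells moved
     to the other sides. *)
  apply (invertible_cancel_l (invertible_eq_arr (comp_assoc f' g' h'))).
  apply (invertible_cancel_r (invertible_eq_arr (comp_assoc f g h))).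
  rewrite !cmp_assoc, eq_arrK_sym, cmp_idl, <- !cmp_assoc, eq_arr_symK, cmp_idr.
  symmetry; apply hcomp_assoc.
- apply hcomp_1r.
- apply hcomp_1l.
Defined.

Lemma factors_through_opposite (L : two_category) (O A B : L) (f : Hom A B) :
  @factors_through (opposite_two_category L) O B A f <-> factors_through O f.
Proof. split; intros [a [b E]]; exists b, a; exact E. Qed.

(** Reversing 1-cells exchanges the two halves of the definition of a bizero
    object and keeps the class of null 1-cells, so the same zero object is
    strong. *)
Definition opposite (L : bizero_2category) : bizero_2category.
Proof.
refine (@Bizero2Category (opposite_two_category L) (zero (b := L)) _).
destruct (zero_strong L) as [Z S]; split.
- intro A; destruct (Z A); split; assumption.
- intros A B f g Hf Hg; apply (S B A);
    apply (@factors_through_opposite L (zero (b := L)) B A); assumption.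
Defined.

Lemma iso_null_opposite (L : bizero_2category) (A B : L) (f : Hom A B) :
  @iso_null (opposite L) B A f <-> iso_null f.
Proof.
split; intros [n [Hn E]]; exists n; (split; [| exact E]);
  apply (@factors_through_opposite L (zero (b := L)) A B); exact Hn.
Qed.

Lemma is_2kernel_opposite (L : bizero_2category) (A B Q : L) (c : Hom A B)
    (q : Hom B Q) : @is_2kernel (opposite L) B A Q c q <-> is_2cokernel c q.
Proof.
split; intros [H1 [H2 H3]]; (split; [| split; [| exact H3]]).
- apply iso_null_opposite; exact H1.
- intros Z z Hz; apply H2, iso_null_opposite, Hz.
- apply iso_null_opposite; exact H1.
- intros Z z Hz.
  exact (H2 Z z (proj1 (@iso_null_opposite L A Z (@comp L A B Z z c)) Hz)).
Qed.

Lemma is_2cokernel_opposite (L : bizero_2category) (A B K : L) (c : Hom A B)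
    (k : Hom K A) : @is_2cokernel (opposite L) B A K c k <-> is_2kernel c k.
Proof.
split; intros [H1 [H2 H3]]; (split; [| split; [| exact H3]]).
- apply iso_null_opposite; exact H1.
- intros Z z Hz; apply H2, iso_null_opposite, Hz.
- apply iso_null_opposite; exact H1.
- intros Z z Hz.
  exact (H2 Z z (proj1 (@iso_null_opposite L Z B (@comp L Z A B c z)) Hz)).
Qed.

Lemma is_equivalence_opposite (L : two_category) (A B : L) (f : Hom A B) :
  @is_equivalence (opposite_two_category L) B A f <-> is_equivalence f.
Proof. split; intros [g [H1 H2]]; exists g; split; assumption. Qed.

Lemma is_equivalence_2epi (L : two_category) (A B : L) (f : Hom A B) :
  is_equivalence f -> is_2epi f.
Proof.
intro H; exact (is_equivalence_2mono (proj2 (is_equivalence_opposite f) H)).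
Qed.

Lemma is_2cokernel_postcomp_equivalence (L : bizero_2category) (A B Q Q' : L)
    (c : Hom A B) (e : Hom B Q) (m : Hom Q Q') (g : Hom B Q') :
  is_2cokernel c e -> is_equivalence m -> g ~= m <o> e -> is_2cokernel c g.
Proof.
intros He Hm E; apply is_2kernel_opposite.
exact (@is_2kernel_precomp_equivalence (opposite L) _ _ _ _ c e m g
  (proj2 (is_2kernel_opposite c e) He)
  (proj2 (is_equivalence_opposite m) Hm) E).
Qed.

(** The dual of [epi_part_is_equivalence]: reversing 1-cells exchanges [k'] with
    [q], [q'] with [k], [f] with [h] and [e] with [m]. *)
Lemma mono_part_is_equivalence (L : bizero_2category)
    (K' A' Q' K A Q I W : L)
    (k' : Hom K' A') (q' : Hom A' Q') (k : Hom K A) (q : Hom A Q)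
    (f : Hom K' K) (g : Hom A' A) (h : Hom Q' Q)
    (e : Hom A' I) (m : Hom I A) (c : Hom A W) :
  is_2cokernel k q -> is_2epi q' ->
  g <o> k' ~= k <o> f -> h <o> q' ~= q <o> g ->
  is_2kernel c m -> g ~= m <o> e ->
  is_2epi f -> is_2epi h -> is_equivalence m.
Proof.
intros Hq Hq' EK EQ Hm E Hf Hh; apply is_equivalence_opposite.
exact (@epi_part_is_equivalence (opposite L) Q A K Q' A' K' I W
  q k q' k' h g f c m e (proj2 (is_2kernel_opposite k q) Hq) Hq'
  (isomorphic_sym EQ) (isomorphic_sym EK)
  (proj2 (is_2cokernel_opposite c m) Hm) E Hh Hf).
Qed.

(** * Morphisms of short 2-exact sequences *)

Theorem theorem3p28 (L : bizero_2category) (HL : is_2z_exact L)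
  (K' A' Q' K A Q : L)
  (k' : Hom K' A') (q' : Hom A' Q') (k : Hom K A) (q : Hom A Q)
  (Hkq' : short_2exact k' q') (Hkq : short_2exact k q)
  (f : Hom K' K) (g : Hom A' A) (h : Hom Q' Q)
  (phiK : g <o> k' ==> k <o> f) (HphiK : invertible phiK)
  (phiQ : h <o> q' ==> q <o> g) (HphiQ : invertible phiQ)
  (Hg : is_normal g) :
  (is_2mono f -> is_2mono h -> is_normal_2mono g) /\
  (is_2epi f -> is_2epi h -> is_normal_2epi g) /\
  (is_equivalence f -> is_equivalence h -> is_equivalence g).
Proof.
destruct Hkq' as [Hk' Hq'], Hkq as [Hk Hq].
destruct Hg as [I [e [m [[W [w He]] [[C [c Hm]] E]]]]].
assert (EK : g <o> k' ~= k <o> f) by (exists phiK; exact HphiK).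
assert (EQ : h <o> q' ~= q <o> g) by (exists phiQ; exact HphiQ).
pose proof (epi_part_is_equivalence Hk' (is_2kernel_2mono Hk) EK EQ He E)
  as e_equiv.
pose proof (mono_part_is_equivalence Hq (is_2cokernel_2epi Hq') EK EQ Hm E)
  as m_equiv.
split; [| split]; intros Hf Hh.
- exists C, c; exact (is_2kernel_precomp_equivalence Hm (e_equiv Hf Hh) E).
- exists W, w; exact (is_2cokernel_postcomp_equivalence He (m_equiv Hf Hh) E).
- apply (@is_equivalence_comp L _ _ _ m e g); [| | exact E].
  + apply m_equiv; apply is_equivalence_2epi; assumption.
  + apply e_equiv; apply is_equivalence_2mono; assumption.
Qed.
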